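(* Let $k\ge1$ and let $\mathfrak q$ be a $\mathsf{Lie}$-nilpotent Leibniz algebra of class at most $k$ (i.e. $\gamma_{k+1}^{\mathsf{Lie}}(\mathfrak q)=0$) such that $\mathcal M_{\mathsf{Lie}}^{(c)}(\mathfrak q)\ne0$ for some $c>k$. Then $\mathfrak q$ has no $c$-$\mathsf{Lie}$-covering.
   Context: $\mathbb K$ is a field with $\frac12\in\mathbb K$. A Leibniz algebra is a $\mathbb K$-vector space with a bilinear bracket satisfying $[x,[y,z]]=[[x,y],z]-[[x,z],y]$. For two-sided ideals $\mathfrak m,\mathfrak n$ of $\mathfrak g$, $[\mathfrak m,\mathfrak n]_{\mathsf{Lie}}$ is the span of all $[m,n]+[n,m]$, $m\in\mathfrak m$, $n\in\mathfrak n$. For a two-sided ideal $\mathfrak n$: $\gamma_1^{\mathsf{Lie}}(\mathfrak g,\mathfrak n)=\mathfrak n$, $\gamma_i^{\mathsf{Lie}}(\mathfrak g,\mathfrak n)=[\gamma_{i-1}^{\mathsf{Lie}}(\mathfrak g,\mathfrak n),\mathfrak g]_{\mathsf{Lie}}$ for $i\ge2$, and $\gamma_i^{\mathsf{Lie}}(\mathfrak g)=\gamma_i^{\mathsf{Lie}}(\mathfrak g,\mathfrak g)$. $\mathcal M_{\mathsf{Lie}}^{(c)}(\mathfrak q)=(\mathfrak r\cap\gamma_{c+1}^{\mathsf{Lie}}(\mathfrak f))/\gamma_{c+1}^{\mathsf{Lie}}(\mathfrak f,\mathfrak r)$, computed from a free presentation $0\to\mathfrak r\to\mathfrak f\to\mathfrak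 q\to0$ ($\mathfrak f$ a free Leibniz algebra). A short exact sequence of Leibniz algebras $0\to\mathfrak m\to\mathfrak q^{\ast}\to\mathfrak q\to0$ is a $c$-$\mathsf{Lie}$-stem cover of $\mathfrak q$ if $\gamma_{c+1}^{\mathsf{Lie}}(\mathfrak q^{\ast},\mathfrak m)=0$, $\mathfrak m\subseteq\gamma_{c+1}^{\mathsf{Lie}}(\mathfrak q^{\ast})$ and $\mathfrak m\cong\mathcal M_{\mathsf{Lie}}^{(c)}(\mathfrak q)$; then $\mathfrak q^{\ast}$ is called a $c$-$\mathsf{Lie}$-covering of $\mathfrak q$. *)

(* Defs.v *)
From HB Require Import structures.
From mathcomp Require Import all_boot all_order all_algebra.
From mathcomp Require Import boolp classical_sets.

Set Implicit Arguments.
Unset Strict Implicit.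
Unset Printing Implicit Defensive.

Import GRing.Theory.
Local Open Scope ring_scope.
Local Open Scope classical_set_scope.
Local Open Scope quotient_scope.

(* Right Leibniz algebras over a field; no dimension restriction. *)
HB.mixin Record Lmodule_isLeibniz (K : fieldType) (V : Type)
    of GRing.Lmodule K V := {
  lbr : V -> V -> V;
  lbr_linearl : forall (a : K) (x y z : V),
    lbr (a *: x + y) z = a *: lbr x z + lbr y z;
  lbr_linearr : forall (a : K) (x y z : V),
    lbr z (a *: x + y) = a *: lbr z x + lbr z y;
  lbr_leibniz : forall x y z : V,
    lbr x (lbr y z) = lbr (lbr x y) z - lbr (lbr x z) y
}.

#[short(type="leibnizType")]
HB.structure Definition Leibniz (K : fieldType) :=
  {V of GRing.Lmodule K V & Lmodule_isLeibniz K V}.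

Section Ideals.
Variables (K : fieldType) (g : leibnizType K).
Implicit Types (I J S : set g) (x y z : g).

Definition two_sided_ideal I : Prop :=
  [/\ I 0,
      forall (a : K) x y, I x -> I y -> I (a *: x + y),
      forall x y, I x -> I (lbr x y)
    & forall x y, I y -> I (lbr x y)].

Definition lspan S : set g :=
  [set x | exists s : seq (K * g),
     (forall p, p \in s -> S p.2) /\ x = \sum_(p <- s) p.1 *: p.2].

Definition lie_comm I J : set g :=
  lspan [set z | exists m n, [/\ I m, J n & z = lbr m n + lbr n m]].

(* Indexed from 1; the value at index 0 is the junk value I. *)
Definition lie_gamma I (i : nat) : set g :=
  iter i.-1 (fun S => lie_comm S [set: g]) I.

Definition lie_nilpotent_le (k : nat) : Prop :=
  lie_gamma [set: g] k.+1 = [set 0].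

Lemma lbrDr x y z : lbr z (x + y) = lbr z x + lbr z y.
Proof. by have := lbr_linearr 1 x y z; rewrite !scale1r. Qed.

Lemma lbrDl x y z : lbr (x + y) z = lbr x z + lbr y z.
Proof. by have := lbr_linearl 1 x y z; rewrite !scale1r. Qed.

Lemma lbrBr x y z : lbr z (x - y) = lbr z x - lbr z y.
Proof. by have := lbr_linearr (-1) y x z; rewrite !scaleN1r addrC => ->; rewrite addrC. Qed.

Lemma lbrBl x y z : lbr (x - y) z = lbr x z - lbr y z.
Proof. by have := lbr_linearl (-1) y x z; rewrite !scaleN1r addrC => ->; rewrite addrC. Qed.

Lemma lbr0r x : lbr x 0 = 0 :> g.
Proof. by have := lbrBr 0 0 x; rewrite !subrr. Qed.

Lemma lbr0l x : lbr 0 x = 0 :> g.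
Proof. by have := lbrBl 0 0 x; rewrite !subrr. Qed.

Lemma lbr_sym0 x y z : lbr x (lbr y z + lbr z y) = 0.
Proof. by rewrite lbrDr !lbr_leibniz addrA subrK subrr. Qed.

Lemma lspan_sub S x : S x -> lspan S x.
Proof.
move=> Sx; exists [:: (1, x)]; rewrite big_seq1 scale1r; split=> // p.
by rewrite inE => /eqP ->.
Qed.

Lemma lspan0 S : lspan S 0.
Proof. by exists [::]; rewrite big_nil. Qed.

Lemma lspan_lin S (a : K) x y :
  lspan S x -> lspan S y -> lspan S (a *: x + y).
Proof.
move=> [s [Ss ->]] [t [St ->]].
exists ([seq (a * p.1, p.2) | p <- s] ++ t); split.
  move=> p; rewrite mem_cat => /orP[/mapP[r rs ->]|]; [exact: (Ss _ rs)|exact: St].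
rewrite big_cat big_map scaler_sumr; congr (_ + _).
by apply: eq_bigr => p _; rewrite scalerA.
Qed.

Lemma lspan_min S I :
  I 0 -> (forall (a : K) x y, I x -> I y -> I (a *: x + y)) ->
  (forall x, S x -> I x) -> forall x, lspan S x -> I x.
Proof.
move=> I0 Ilin SI x [s [Ss ->]]; rewrite big_seq_cond.
elim/big_rec: _ => // p y /andP[ps _] Iy; apply: Ilin => //; exact/SI/Ss.
Qed.

Lemma lie_comm_subset I I' J : I `<=` I' -> lie_comm I J `<=` lie_comm I' J.
Proof.
move=> II' x; apply: lspan_min; [exact: lspan0|by move=> *; exact: lspan_lin|].
by move=> _ [m [n [/II' Im Jn ->]]]; apply: lspan_sub; exists m, n.
Qed.

Lemma lie_comm_subl I J : two_sided_ideal I -> lie_comm I J `<=` I.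
Proof.
move=> [I0 Ilin Il Ir] x; apply: lspan_min => // _ [m [n [Im _ ->]]].
by rewrite -[lbr m n]scale1r; apply: Ilin; [exact: Il|exact: Ir].
Qed.

Lemma two_sided_idealT : two_sided_ideal [set: g].
Proof. by []. Qed.

Lemma two_sided_idealI I J :
  two_sided_ideal I -> two_sided_ideal J -> two_sided_ideal (I `&` J).
Proof.
move=> [I0 Ilin Il Ir] [J0 Jlin Jl Jr]; split=> //.
- by move=> a x y [? ?] [? ?]; split; [exact: Ilin|exact: Jlin].
- by move=> x y [? ?]; split; [exact: Il|exact: Jl].
- by move=> x y [? ?]; split; [exact: Ir|exact: Jr].
Qed.

Lemma two_sided_ideal_lie_comm I J :
  two_sided_ideal I -> two_sided_ideal J -> two_sided_ideal (lie_comm I J).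
Proof.
move=> [_ _ Il Ir] [_ _ Jl Jr]; split.
- exact: lspan0.
- by move=> a x y; exact: lspan_lin.
- move=> x y; apply: (@lspan_min _ [set u | lie_comm I J (lbr u y)]) => /=.
  + by rewrite lbr0l; exact: lspan0.
  + by move=> a u v Hu Hv; rewrite lbr_linearl; exact: lspan_lin.
  + move=> _ [m [n [Im Jn ->]]].
    have -> : lbr (lbr m n + lbr n m) y =
      1 *: (lbr m (lbr n y) + lbr (lbr n y) m) +
      (lbr (lbr m y) n + lbr n (lbr m y)).
      rewrite scale1r lbrDl (lbr_leibniz m n) (lbr_leibniz n m).
      by rewrite addrACA subrK [X in _ = _ + X]addrC subrK.
    apply: lspan_lin; apply: lspan_sub.
      by exists m, (lbr n y); split=> //; exact: Jl.
    by exists (lbr m y), n; split=> //; exact: Il.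
- move=> x; apply: lspan_min.
  + by rewrite lbr0r; exact: lspan0.
  + by move=> a u v Hu Hv; rewrite lbr_linearr; exact: lspan_lin.
  + by move=> _ [m [n [_ _ ->]]]; rewrite lbr_sym0; exact: lspan0.
Qed.

Lemma two_sided_ideal_gamma I i :
  two_sided_ideal I -> two_sided_ideal (lie_gamma I i).
Proof.
move=> HI; rewrite /lie_gamma; elim: i.-1 => //= n.
by move=> IH; exact: two_sided_ideal_lie_comm.
Qed.

Lemma lie_gamma_sub I i : two_sided_ideal I -> lie_gamma I i `<=` I.
Proof.
move=> HI; rewrite /lie_gamma; elim: i.-1 => //= n IH.
apply: subset_trans IH; apply: lie_comm_subl.
exact: (two_sided_ideal_gamma n.+1 HI).
Qed.

Lemma lie_gamma_subset I J i : I `<=` J -> lie_gamma I i `<=` lie_gamma J i.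
Proof.
move=> IJ; rewrite /lie_gamma; elim: i.-1 => //= n; exact: lie_comm_subset.
Qed.

End Ideals.

Arguments lie_nilpotent_le {K} g k.

Record ideal (K : fieldType) (g : leibnizType K) := Ideal {
  ideal_set : set g;
  idealP : two_sided_ideal ideal_set
}.

Definition ideal_mem (K : fieldType) (g : leibnizType K) (I : ideal g)
  : {pred g} := fun x => x \in ideal_set I.

Lemma ideal_memP (K : fieldType) (g : leibnizType K) (I : ideal g) x :
  x \in ideal_mem I <-> ideal_set I x.
Proof. by split=> [/set_mem|/mem_set]. Qed.

Lemma ideal_mem_closed (K : fieldType) (g : leibnizType K) (I : ideal g) :
  GRing.subsemimod_closed (ideal_mem I).
Proof.
have [I0 Ilin _ _] := idealP I; apply: GRing.submod_closed_semi; split.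
  exact/ideal_memP.
by move=> a x y /ideal_memP Ix /ideal_memP Iy; apply/ideal_memP; exact: Ilin.
Qed.

HB.instance Definition _ (K : fieldType) (g : leibnizType K) (I : ideal g) :=
  GRing.isSubmodClosed.Build K g (ideal_mem I) (ideal_mem_closed I).

(* An ideal regarded as a Leibniz algebra in its own right. *)
Section SubAlgebra.
Variables (K : fieldType) (g : leibnizType K) (I : ideal g).

Record subalg := SubAlg { subalg_val : g; _ : subalg_val \in ideal_mem I }.

HB.instance Definition _ := [isSub for subalg_val].
HB.instance Definition _ := [Choice of subalg by <:].
HB.instance Definition _ := [SubChoice_isSubZmodule of subalg by <:].
HB.instance Definition _ := [SubZmodule_isSubLmodule of subalg by <:].

Fact sub_lbr_subproof (x y : subalg) : lbr (val x) (val y) \in ideal_mem I.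
Proof.
by have [_ _ Il _] := idealP I; apply/ideal_memP/Il/ideal_memP/(valP x).
Qed.

Definition sub_lbr (x y : subalg) : subalg := SubAlg (sub_lbr_subproof x y).

Fact sub_lbr_linearl (a : K) (x y z : subalg) :
  sub_lbr (a *: x + y) z = a *: sub_lbr x z + sub_lbr y z.
Proof. by apply: val_inj; rewrite /= lbr_linearl. Qed.

Fact sub_lbr_linearr (a : K) (x y z : subalg) :
  sub_lbr z (a *: x + y) = a *: sub_lbr z x + sub_lbr z y.
Proof. by apply: val_inj; rewrite /= lbr_linearr. Qed.

Fact sub_lbr_leibniz (x y z : subalg) :
  sub_lbr x (sub_lbr y z) = sub_lbr (sub_lbr x y) z - sub_lbr (sub_lbr x z) y.
Proof. by apply: val_inj; rewrite /= lbr_leibniz. Qed.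

HB.instance Definition _ := Lmodule_isLeibniz.Build K subalg
  sub_lbr_linearl sub_lbr_linearr sub_lbr_leibniz.

Fact ideal_restr_subproof (J : ideal g) :
  two_sided_ideal [set x : subalg | ideal_set J (val x)].
Proof.
have [J0 Jlin Jl Jr] := idealP J; split=> //=.
- by move=> a x y; exact: Jlin.
- by move=> x y; exact: Jl.
- by move=> x y; exact: Jr.
Qed.

Definition ideal_restr (J : ideal g) : ideal subalg :=
  Ideal (ideal_restr_subproof J).

End SubAlgebra.

(* The additive quotient is the library's; scaling and bracket descend to it. *)
Section QuotientAlgebra.
Variables (K : fieldType) (g : leibnizType K) (I : ideal g).

Definition quotalg : Type := Quotient.quot (ideal_mem I).

HB.instance Definition _ := GRing.Zmodule.on quotalg.
HB.instance Definition _ := EqQuotient.on quotalg.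

Definition quot_pi (x : g) : quotalg := \pi_quotalg x.

Lemma quot_piE x y : quot_pi x = quot_pi y <-> ideal_set I (x - y).
Proof.
rewrite -ideal_memP; split=> [/eqP|]; first by rewrite -Quotient.idealrBE.
by rewrite Quotient.idealrBE => /eqP.
Qed.

Lemma quot_piD x y : quot_pi (x + y) = quot_pi x + quot_pi y.
Proof. exact: (@Quotient.pi_add _ (ideal_mem I)). Qed.

Lemma quot_piN x : quot_pi (- x) = - quot_pi x.
Proof. exact: (@Quotient.pi_opp _ (ideal_mem I)). Qed.

Lemma quot_repr (u : quotalg) : quot_pi (repr u) = u.
Proof. exact: reprK. Qed.

Definition quot_scale (a : K) (u : quotalg) : quotalg := quot_pi (a *: repr u).

Definition quot_lbr (u v : quotalg) : quotalg := quot_pi (lbr (repr u) (repr v)).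

Lemma quot_piZ a x : quot_scale a (quot_pi x) = quot_pi (a *: x).
Proof.
have [I0 Ilin _ _] := idealP I; apply/quot_piE.
by rewrite -scalerBr -[_ *: _]addr0; apply: Ilin => //; apply/quot_piE/quot_repr.
Qed.

Lemma quot_pi_lbr x y : quot_lbr (quot_pi x) (quot_pi y) = quot_pi (lbr x y).
Proof.
have [I0 Ilin Il Ir] := idealP I; apply/quot_piE.
set x' := repr _; set y' := repr _.
have -> : lbr x' y' - lbr x y = 1 *: lbr (x' - x) y' + lbr x (y' - y).
  by rewrite scale1r lbrBl lbrBr addrA subrK.
apply: Ilin; [apply: Il | apply: Ir]; exact/quot_piE/quot_repr.
Qed.

Fact quot_scalerA a b u : quot_scale a (quot_scale b u) = quot_scale (a * b) u.
Proof. by rewrite -[u]quot_repr !quot_piZ scalerA. Qed.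

Fact quot_scale1r : left_id 1 quot_scale.
Proof. by move=> u; rewrite -[u]quot_repr quot_piZ scale1r. Qed.

Fact quot_scalerDr : right_distributive quot_scale +%R.
Proof.
move=> a u v; rewrite -[u]quot_repr -[v]quot_repr.
by rewrite -quot_piD !quot_piZ scalerDr quot_piD.
Qed.

Fact quot_scalerDl u : {morph quot_scale^~ u : a b / a + b}.
Proof.
by move=> a b; rewrite -[u]quot_repr !quot_piZ scalerDl quot_piD.
Qed.

HB.instance Definition _ := GRing.Zmodule_isLmodule.Build K quotalg
  quot_scalerA quot_scale1r quot_scalerDr quot_scalerDl.

Fact quot_lbr_linearl (a : K) (u v w : quotalg) :
  quot_lbr (a *: u + v) w = a *: quot_lbr u w + quot_lbr v w.
Proof.
rewrite -[u]quot_repr -[v]quot_repr -[w]quot_repr.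
rewrite -[a *: quot_pi _]/(quot_scale _ _) quot_piZ -quot_piD !quot_pi_lbr.
by rewrite -[a *: quot_pi _]/(quot_scale _ _) quot_piZ -quot_piD lbr_linearl.
Qed.

Fact quot_lbr_linearr (a : K) (u v w : quotalg) :
  quot_lbr w (a *: u + v) = a *: quot_lbr w u + quot_lbr w v.
Proof.
rewrite -[u]quot_repr -[v]quot_repr -[w]quot_repr.
rewrite -[a *: quot_pi _]/(quot_scale _ _) quot_piZ -quot_piD !quot_pi_lbr.
by rewrite -[a *: quot_pi _]/(quot_scale _ _) quot_piZ -quot_piD lbr_linearr.
Qed.

Fact quot_lbr_leibniz (u v w : quotalg) :
  quot_lbr u (quot_lbr v w) = quot_lbr (quot_lbr u v) w - quot_lbr (quot_lbr u w) v.
Proof.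
rewrite -[u]quot_repr -[v]quot_repr -[w]quot_repr !quot_pi_lbr.
by rewrite -quot_piN -quot_piD lbr_leibniz.
Qed.

HB.instance Definition _ := Lmodule_isLeibniz.Build K quotalg
  quot_lbr_linearl quot_lbr_linearr quot_lbr_leibniz.

End QuotientAlgebra.

Definition leibniz_hom (K : fieldType) (g h : leibnizType K)
    (phi : {linear g -> h}) : Prop :=
  forall x y, phi (lbr x y) = lbr (phi x) (phi y).

Definition leibniz_iso (K : fieldType) (g h : leibnizType K) : Prop :=
  exists phi : {linear g -> h}, leibniz_hom phi /\ bijective phi.

Definition lker (K : fieldType) (g h : leibnizType K)
    (phi : {linear g -> h}) : set g := [set x | phi x = 0].

Definition short_exact (K : fieldType) (m e q : leibnizType K)
    (i : {linear m -> e}) (p : {linear e -> q}) : Prop :=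
  [/\ leibniz_hom i, leibniz_hom p, injective i,
      range i = lker p & range p = [set: q]].

Definition free_leibniz_on (K : fieldType) (X : Type) (f : leibnizType K)
    (iota : X -> f) : Prop :=
  forall (g : leibnizType K) (h : X -> g),
    (exists phi : {linear f -> g},
       leibniz_hom phi /\ forall x, phi (iota x) = h x) /\
    (forall phi psi : {linear f -> g}, leibniz_hom phi -> leibniz_hom psi ->
       (forall x, phi (iota x) = h x) -> (forall x, psi (iota x) = h x) ->
       phi =1 psi).

(* The kernel term of the presentation is lker fp_map. *)
Record free_presentation (K : fieldType) (q : leibnizType K) := FreePres {
  fp_gens : Type;
  fp_alg : leibnizType K;
  fp_inc : fp_gens -> fp_alg;
  fp_map : {linear fp_alg -> q};
  fp_free : free_leibniz_on fp_inc;
  fp_hom : leibniz_hom fp_map;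
  fp_surj : range fp_map = [set: q]
}.

Arguments fp_free {K q} f.
Arguments fp_hom {K q} f.

Section Multiplier.
Variables (K : fieldType) (q : leibnizType K) (P : free_presentation q).
Variable c : nat.

Lemma two_sided_ideal_lker : two_sided_ideal (lker (fp_map P)).
Proof.
have hom := fp_hom P; split; rewrite /lker /=.
- by rewrite linear0.
- by move=> a x y x0 y0; rewrite linearP x0 y0 scaler0 addr0.
- by move=> x y x0; rewrite hom x0 lbr0l.
- by move=> x y y0; rewrite hom y0 lbr0r.
Qed.

Definition mult_num : ideal (fp_alg P) :=
  Ideal (two_sided_idealI two_sided_ideal_lker
    (two_sided_ideal_gamma c.+1 (two_sided_idealT (fp_alg P)))).

Definition mult_den : ideal (fp_alg P) :=
  Ideal (two_sided_ideal_gamma c.+1 two_sided_ideal_lker).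

Lemma mult_den_sub : ideal_set mult_den `<=` ideal_set mult_num.
Proof.
move=> x Hx; split; first exact: (lie_gamma_sub two_sided_ideal_lker Hx).
exact: (lie_gamma_subset _ Hx).
Qed.

(* mult_num / mult_den, with mult_den viewed inside the subalgebra mult_num. *)
Definition lie_multiplier : leibnizType K :=
  quotalg (ideal_restr mult_num mult_den).

End Multiplier.

Arguments lie_multiplier {K q} P c.

(* The multiplier, hence also the notion of covering, is computed from the free
   presentation P; no presentation-independence is assumed. *)
Definition lie_stem_cover (K : fieldType) (c : nat) (m e q : leibnizType K)
    (P : free_presentation q) (i : {linear m -> e}) (p : {linear e -> q})
    : Prop :=
  [/\ short_exact i p,
      lie_gamma (range i) c.+1 = [set 0],
      range i `<=` lie_gamma [set: e] c.+1
    & leibniz_iso m (lie_multiplier P c)].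

Definition lie_covering (K : fieldType) (c : nat) (e q : leibnizType K)
    (P : free_presentation q) : Prop :=
  exists (m : leibnizType K) (i : {linear m -> e}) (p : {linear e -> q}),
    lie_stem_cover c P i p.

Arguments lie_covering {K} c e {q} P.

(* Main.v *)
(* In a covering e with kernel m, the class of q gives
   gamma_(k+1)(e) <= m <= gamma_(c+1)(e) <= [gamma_(k+1)(e), e] <= [m, e].
   Iterating m <= [m, e] yields m <= gamma_(c+1)(e, m) = 0, so that the
   multiplier, being isomorphic to m, vanishes. *)
Require Import Defs.
From mathcomp Require Import all_boot all_order all_algebra.
From mathcomp Require Import boolp classical_sets.

Import GRing.Theory.
Local Open Scope ring_scope.

Section LieGamma.
Local Open Scope classical_set_scope.
Variables (K : fieldType) (g : leibnizType K).
Implicit Types I : set g.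

Lemma lie_gammaS I n : lie_gamma I n.+2 = lie_comm (lie_gamma I n.+1) [set: g].
Proof. by []. Qed.

(** Running the first [n - m] steps leaves a subset of the whole algebra, and the remaining [m]
    steps are monotone in their starting set. *)
Lemma lie_gamma_homo m n : (m <= n)%N ->
  lie_gamma [set: g] n.+1 `<=` lie_gamma [set: g] m.+1.
Proof.
move=> /subnKC <-; rewrite /lie_gamma /= iterD.
exact: (@lie_gamma_subset _ _ _ _ m.+1 (@subsetT _ _)).
Qed.

Lemma sub_lie_gamma I n : I `<=` lie_comm I [set: g] -> I `<=` lie_gamma I n.+1.
Proof.
move=> sub_I; elim: n => // n IH.
by apply: (subset_trans sub_I); rewrite lie_gammaS; exact: lie_comm_subset.
Qed.

Lemma lie_gamma_hom (h : leibnizType K) (phi : {linear g -> h}) n :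
  leibniz_hom phi ->
  phi @` lie_gamma [set: g] n.+1 `<=` lie_gamma [set: h] n.+1.
Proof.
move=> hom_phi; elim: n => // n IH _ [x + <-]; rewrite !lie_gammaS.
(* The preimage of the target span under [phi] is a subspace, so only generators need checking. *)
apply: (@lspan_min _ _ _ [set y | lie_comm _ _ (phi y)]) => /=.
- by rewrite linear0; exact: lspan0.
- by move=> a y z Hy Hz; rewrite linearP; exact: lspan_lin.
- move=> _ [m [y [Hm _ ->]]]; rewrite linearD !hom_phi; apply: lspan_sub.
  by exists (phi m), (phi y); split=> //; apply: IH; exists m.
Qed.

Lemma lie_nilpotent_ker_gamma (h : leibnizType K) (phi : {linear g -> h}) k :
  leibniz_hom phi -> lie_nilpotent_le h k ->
  lie_gamma [set: g] k.+1 `<=` Defs.lker phi.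
Proof.
move=> hom_phi nil_h x gx.
have : lie_gamma [set: h] k.+1 (phi x) by apply: lie_gamma_hom => //; exists x.
by rewrite nil_h.
Qed.

End LieGamma.

Theorem theorem5p12 (K : fieldType) (half_K : (2%:R : K) != 0)
    (k : nat) (k_ge1 : (1 <= k)%N) (q : leibnizType K)
    (q_nil : lie_nilpotent_le q k)
    (c : nat) (c_gt_k : (k < c)%N) (P : free_presentation q)
    (mult_neq0 : exists x : lie_multiplier P c, x != 0) :
  ~ exists e : leibnizType K, lie_covering c e P.
Proof.
move=> [e [m [i [p [[_ hom_p inj_i ker_p _] gamma0 stem [phi [_ bij_phi]]]]]]].
have sub_m : subset (range i) (lie_comm (range i) setT).
  (* [k < c] is read as [k.+1 <= c]: the strict inequality puts the stem condition inside term
     [k.+2], which leaves one outer bracket with [e] around term [k.+1]. *)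
  apply: (subset_trans stem); apply: (subset_trans (lie_gamma_homo _ _ _ _ c_gt_k)).
  rewrite lie_gammaS; apply: lie_comm_subset.
  by rewrite ker_p; exact: lie_nilpotent_ker_gamma.
have m0 (x : m) : x = 0.
  apply: inj_i; rewrite linear0.
  have : range i (i x) by exists x.
  by move/(sub_lie_gamma _ _ _ c sub_m); rewrite gamma0.
(* Surjectivity of [phi] carries the vanishing of [m] over to the multiplier. *)
have [psi _ psiK] := bij_phi; have [x /eqP] := mult_neq0; apply.
by rewrite -[x]psiK (m0 (psi x)) linear0.
Qed.
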